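(* Let $f: X \rightarrow Y$ be a coarse map between proper metric spaces, and let $\nu f:\nu X\to\nu Y$ be the induced continuous map between Higson coronas. If $\nu f$ is light, then $f$ is coarsely light.
   Context: A metric space is proper if its closed bounded subsets are compact. A family $\mathcal{U}$ of subsets of a metric space $X$ is uniformly bounded iff there is $M>0$ with $\mathrm{diam}(U)\le M$ for all $U\in\mathcal{U}$; the ls-structure of $X$ is the set of all uniformly bounded families. A map is ls-continuous if it sends uniformly bounded families to uniformly bounded families. A coarse map is an ls-continuous map such that the inverse image of every bounded set is bounded. For a family $\mathcal{U}$ of subsets of $X$ and $A\subseteq X$, the $\mathcal{U}$-components of $A$ are the equivalence classes of the relation on $A$: $x,x'$ are joined by a finite sequence $x=x_1,\dots,x_k=x'$ in $A$ with each pair $x_i,x_{i+1}$ in a common element of $\mathcal{U}$. For ls-continuous $f:X\to Y$ and uniformly bounded $\mathcal{U}$ in $X$, $\mathcal{V}$ in $Y$, $c(\mathcal{U},f,\mathcal{V})$ is the family of all $\mathcal{U}$-components of sets $f^{-1}(V)$, $V\in\mathcal{V}$. The light structure on $X$ with respect to $f$ is the closure under refinement of the set of all $c(\mathcal{U},f,\mathcal{V})$ (all families each of whose elements with more than one point is contained in an element of one fixed $c(\mathcal{U},f,\mathcal{V})$). The map $f$ is coarsely light if the light structure with respect to $f$ equals the ls-structure of $X$ (equivalently, every $c(\mathcal{U},f,\mathcal{V})$ is uniformly bounded). A bounded function $g:X\to\mathbb{C}$ on a metric space is slowly oscillating if for all $R,\varepsilon>0$ there is a bounded $B\subseteq X$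 such that $d(x,x')\le R\Rightarrow |g(x)-g(x')|\le\varepsilon$ for $x,x'\in X\setminus B$. $B_h(X)$ is the $C^*$-algebra of (not necessarily continuous) bounded slowly oscillating functions $X\to\mathbb{C}$ and $B_0(X)$ its ideal of functions tending to $0$ at infinity (for every $\varepsilon>0$, $|g|\le\varepsilon$ outside a bounded set). The Higson corona $\nu X$ of a proper metric space $X$ is the compact Hausdorff space corresponding under Gelfand duality to $B_h(X)/B_0(X)$ (equivalently, $\nu X=hX\setminus X$, with $hX$ the compactification of $X$ to which exactly the continuous bounded slowly oscillating functions extend). A coarse map $f:X\to Y$ induces the $*$-homomorphism $[g]\mapsto[gf]$ from $B_h(Y)/B_0(Y)$ to $B_h(X)/B_0(X)$, which is dual to the continuous map $\nu f:\nu X\to\nu Y$. A continuous map between compact Hausdorff spaces is light if each of its fibres is totally disconnected. *)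

(* Defs.v *)
From HB Require Import structures.
From mathcomp Require Import all_boot all_order all_algebra.
From mathcomp Require Import generic_quotient ring_quotient complex.
From mathcomp Require Import all_classical all_reals all_analysis.

Set Implicit Arguments.
Unset Strict Implicit.
Unset Printing Implicit Defensive.

Import Order.TTheory GRing.Theory Num.Theory.
Import numFieldNormedType.Exports.

Local Open Scope classical_set_scope.
Local Open Scope complex_scope.
Local Open Scope ring_scope.
Local Open Scope quotient_scope.

Section LargeScale.
Context {R : realType}.

Definition diam_le {X : metricType R} (A : set X) (M : R) : Prop :=
  forall x y, A x -> A y -> mdist x y <= M.

Definition mbounded {X : metricType R} (A : set X) : Prop :=
  exists M : R, diam_le A M.

Definition proper_space (X : metricType R) : Prop :=
  forall A : set X, closed A -> mbounded A -> compact A.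

Definition uniformly_bounded {X : metricType R} (U : set (set X)) : Prop :=
  exists2 M : R, 0 < M & forall A, U A -> diam_le A M.

Definition ls_continuous {X Y : metricType R} (f : X -> Y) : Prop :=
  forall U : set (set X), uniformly_bounded U ->
    uniformly_bounded [set f @` A | A in U].

Definition coarse_map {X Y : metricType R} (f : X -> Y) : Prop :=
  ls_continuous f /\ forall B : set Y, mbounded B -> mbounded (f @^-1` B).

(* [s 0, ..., s k] is a chain in A from x to x' with consecutive points in a
   common element of U; k = 0 gives reflexivity. *)
Definition chained {X : metricType R} (U : set (set X)) (A : set X)
    (x x' : X) : Prop :=
  exists (k : nat) (s : nat -> X),
    [/\ s 0%N = x, s k = x',
        (forall i, (i <= k)%N -> A (s i)) &
        (forall i, (i < k)%N -> exists2 V, U V & V (s i) /\ V (s i.+1))].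

Definition ls_components {X : metricType R} (U : set (set X)) (A : set X) :
    set (set X) :=
  [set chained U A x | x in A].

Definition component_family {X Y : metricType R} (U : set (set X))
    (f : X -> Y) (V : set (set Y)) : set (set X) :=
  \bigcup_(B in V) ls_components U (f @^-1` B).

Definition ls_structure (X : metricType R) : set (set (set X)) :=
  [set U | uniformly_bounded U].
#[global] Arguments ls_structure : clear implicits.

Definition light_structure {X Y : metricType R} (f : X -> Y) :
    set (set (set X)) :=
  [set W | exists (U : set (set X)) (V : set (set Y)),
     [/\ uniformly_bounded U, uniformly_bounded V &
         forall A, W A -> (exists x y, [/\ A x, A y & x <> y]) ->
           exists2 C, component_family U f V C & A `<=` C]].

Definition coarsely_light {X Y : metricType R} (f : X -> Y) : Prop :=
  light_structure f = ls_structure X.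

End LargeScale.

Section HigsonAlgebra.
Context {R : realType}.
Local Notation C := R[i].

Definition bounded_function {X : metricType R} (g : X -> C) : Prop :=
  exists M : R, forall x, `|g x| <= M%:C.

Definition slowly_oscillating {X : metricType R} (g : X -> C) : Prop :=
  forall r e : R, 0 < r -> 0 < e -> exists2 B : set X, mbounded B &
    forall x x', ~ B x -> ~ B x' -> mdist x x' <= r -> `|g x - g x'| <= e%:C.

Definition vanishing_at_infinity {X : metricType R} (g : X -> C) : Prop :=
  forall e : R, 0 < e -> exists2 B : set X, mbounded B &
    forall x, ~ B x -> `|g x| <= e%:C.

Definition higson_pred (X : metricType R) : {pred X -> C} :=
  fun g => `[< bounded_function g /\ slowly_oscillating g >].
#[global] Arguments higson_pred : clear implicits.

Lemma mboundedU (X : metricType R) (A B : set X) :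
  mbounded A -> mbounded B -> mbounded (A `|` B).
Proof.
move=> [M hM] [N hN].
have [[a Aa]|A0] := pselect (A !=set0); last first.
  exists N => x y [Ax|Bx]; first by case: A0; exists x.
  by move=> [Ay|By]; [case: A0; exists y|exact: hN].
have [[b Bb]|B0] := pselect (B !=set0); last first.
  exists M => x y [Ax|Bx]; last by case: B0; exists x.
  by move=> [Ay|By]; [exact: hM|case: B0; exists y].
have M0 : 0 <= M by apply: le_trans (hM _ _ Aa Aa); exact: mdist_ge0.
have N0 : 0 <= N by apply: le_trans (hN _ _ Bb Bb); exact: mdist_ge0.
have d0 : 0 <= mdist a b by exact: mdist_ge0.
have AB x y : A x -> B y -> mdist x y <= M + (mdist a b + N).
  move=> Ax By; apply: (le_trans (metric_triangle x a y)).
  apply: lerD; first exact: hM.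
  by apply: (le_trans (metric_triangle a b y)); rewrite lerD2l; exact: hN.
exists (M + (mdist a b + N)) => x y [Ax|Bx] [Ay|By].
- by apply: (le_trans (hM _ _ Ax Ay)); rewrite lerDl addr_ge0.
- exact: AB.
- by rewrite metric_sym; exact: AB.
- by apply: (le_trans (hN _ _ Bx By)); rewrite addrA lerDr addr_ge0.
Qed.

Lemma higson_pred_subring (X : metricType R) : subring_closed (higson_pred X).
Proof.
split.
- apply/asboolP; split; first by exists 1 => x; rewrite normr1.
  move=> r e r0 e0; exists set0; first by exists 0.
  by move=> x x' _ _ _; rewrite subrr normr0 lecR ltW.
- move=> g h /asboolP[[M gM] gs] /asboolP[[N hN] hs]; apply/asboolP; split.
    exists (M + N) => x; rewrite rmorphD/=.
    by apply: (le_trans (ler_normB _ _)); exact: lerD.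
  move=> r e r0 e0; have e20 : 0 < e / 2 by rewrite divr_gt0.
  have [B1 b1 H1] := gs r _ r0 e20; have [B2 b2 H2] := hs r _ r0 e20.
  exists (B1 `|` B2); first exact: mboundedU.
  move=> x x' /not_orP[x1 x2] /not_orP[x'1 x'2] d.
  have -> : (g - h) x - (g - h) x' = (g x - g x') - (h x - h x').
    rewrite -[(g - h) x]/(g x - h x) -[(g - h) x']/(g x' - h x').
    by rewrite opprD addrACA -opprD.
  rewrite [e]splitr rmorphD/=.
  by apply: (le_trans (ler_normB _ _)); apply: lerD; [exact: H1|exact: H2].
- move=> g h /asboolP[[M gM] gs] /asboolP[[N hN] hs]; apply/asboolP; split.
    exists (M * N) => x; rewrite rmorphM/= normrM.
    by apply: ler_pM.
  move=> r e r0 e0.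
  pose K := 1 + `|M| + `|N|.
  have K0 : 0 < K by rewrite /K -addrA ltr_wpDr// addr_ge0.
  have MK : M <= K.
    by rewrite (le_trans (ler_norm _))// /K addrAC lerDr addr_ge0.
  have NK : N <= K by rewrite (le_trans (ler_norm _))// /K lerDr addr_ge0.
  have [q q0 eE] : exists2 q, 0 < q & e = K * q + q * K.
    exists (e / 2 / K); first by rewrite !divr_gt0.
    by rewrite mulrC divfK ?gt_eqF// -splitr.
  have [B1 b1 H1] := gs r _ r0 q0; have [B2 b2 H2] := hs r _ r0 q0.
  exists (B1 `|` B2); first exact: mboundedU.
  move=> x x' /not_orP[x1 x2] /not_orP[x'1 x'2] d.
  have -> : (g * h) x - (g * h) x' = g x * (h x - h x') + (g x - g x') * h x'.
    rewrite -[(g * h) x]/(g x * h x) -[(g * h) x']/(g x' * h x').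
    by rewrite mulrBr mulrBl addrA subrK.
  rewrite eE rmorphD/= !rmorphM/=.
  apply: (le_trans (ler_normD _ _)); rewrite !normrM; apply: lerD.
    by apply: ler_pM => //; [rewrite (le_trans (gM x))// lecR|exact: H2].
  by apply: ler_pM => //; [exact: H1|rewrite (le_trans (hN x'))// lecR].
Qed.

HB.instance Definition _ (X : metricType R) :=
  GRing.isSubringClosed.Build (X -> C) (higson_pred X) (@higson_pred_subring X).

Lemma higson_pred_cst (X : metricType R) (a : C) :
  (cst a : X -> C) \in higson_pred X.
Proof.
apply/asboolP; split.
  by exists (complex.Re `|a|) => x; rewrite RRe_real ?normr_real.
move=> r e r0 e0; exists set0; first by exists 0.
by move=> x x' _ _ _; rewrite subrr normr0 lecR ltW.
Qed.

Lemma higson_predZ (X : metricType R) :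
  GRing.scaler_closed (higson_pred X : {pred X -> C}).
Proof. by move=> a g gX; exact: (rpredM (higson_pred_cst X a) gX). Qed.

HB.instance Definition _ (X : metricType R) :=
  GRing.isScaleClosed.Build C (X -> C) (higson_pred X) (@higson_predZ X).

(* The algebra B_h(X). Commutative unital rings are possibly trivial here
   (comPzRingType), as X may be empty and, below, B_0(X) may be all of
   B_h(X). *)
Definition higson_fun (X : metricType R) : Type :=
  {g : X -> C | g \in higson_pred X}.

HB.instance Definition _ (X : metricType R) :=
  SubChoice.on (higson_fun X).
HB.instance Definition _ (X : metricType R) :=
  GRing.SubChoice_isSubComPzRing.Build _ _ (higson_fun X)
    (subringClosedP (higson_pred X)).
HB.instance Definition _ (X : metricType R) :=
  [SubZmodule_isSubLmodule of higson_fun X by <:].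

(* The ideal B_0(X) of B_h(X). *)
Definition higson0 (X : metricType R) : {pred higson_fun X} :=
  fun g => `[< vanishing_at_infinity (\val g : X -> C) >].
#[global] Arguments higson0 : clear implicits.

Lemma higson0_zmod (X : metricType R) : zmod_closed (higson0 X).
Proof.
split.
  apply/asboolP => e e0; exists set0; first by exists 0.
  by move=> x _; rewrite normr0 lecR ltW.
move=> g h /asboolP g0 /asboolP h0; apply/asboolP => e e0.
have e20 : 0 < e / 2 by rewrite divr_gt0.
have [B1 b1 H1] := g0 _ e20; have [B2 b2 H2] := h0 _ e20.
exists (B1 `|` B2); first exact: mboundedU.
move=> x /not_orP[x1 x2]; rewrite -[X in `|X|]/(\val g x - \val h x).
rewrite [e]splitr rmorphD/=.
by apply: (le_trans (ler_normB _ _)); apply: lerD; [exact: H1|exact: H2].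
Qed.

HB.instance Definition _ (X : metricType R) :=
  GRing.isZmodClosed.Build (higson_fun X) (higson0 X) (@higson0_zmod X).

Lemma higson0M (X : metricType R) (g h : higson_fun X) :
  h \in higson0 X -> g * h \in higson0 X.
Proof.
move=> /asboolP h0; apply/asboolP => e e0.
have /asboolP[[M gM] _] := valP g.
have K0 : 0 < 1 + `|M| by rewrite ltr_wpDr.
have [q q0 eE] : exists2 q, 0 < q & e = (1 + `|M|) * q.
  by exists (e / (1 + `|M|)); rewrite ?divr_gt0// mulrC divfK ?gt_eqF.
have [B b H] := h0 q q0.
exists B => // x xB; rewrite -[X in `|X|]/(\val g x * \val h x).
rewrite normrM eE rmorphM/=; apply: ler_pM => //; last exact: H.
by rewrite (le_trans (gM x))// lecR (le_trans (ler_norm _))// lerDr.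
Qed.

(* B_h(X)/B_0(X). The ring structure of ring_quotient requires a proper ideal,
   which B_0(X) is not for bounded X, hence the instances below. *)
Definition higson_quot (X : metricType R) : Type :=
  Quotient.quot (higson0 X : zmodClosed (higson_fun X)).

HB.instance Definition _ (X : metricType R) := GRing.Zmodule.on (higson_quot X).
HB.instance Definition _ (X : metricType R) :=
  EqQuotient.on (higson_quot X).

Section QuotientAlgebra.
Variable X : metricType R.
Local Notation Q := (higson_quot X).
Local Notation B := (higson_fun X).

Lemma higson_quotP (g h : B) : \pi_Q g = \pi_Q h <-> g - h \in higson0 X.
Proof. by rewrite Quotient.idealrBE; split=> [->//|/eqP]. Qed.

Definition hq_one : Q := \pi_Q 1.
Definition hq_mul (a b : Q) : Q := \pi_Q (repr a * repr b).
Definition hq_scale (c : C) (a : Q) : Q := \pi_Q (c *: repr a).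

Lemma higson_piD (g h : B) : \pi_Q (g + h) = \pi_Q g + \pi_Q h.
Proof. exact: (raddfD (\pi_Q : {additive B -> Q})). Qed.

Lemma hq_repr (g : B) : repr (\pi_Q g) - g \in higson0 X.
Proof. by apply/higson_quotP; rewrite reprK. Qed.

Lemma hq_piM (g h : B) : hq_mul (\pi_Q g) (\pi_Q h) = \pi_Q (g * h).
Proof.
apply/higson_quotP; set g' := repr _; set h' := repr _.
have -> : g' * h' - g * h = g' * (h' - h) + h * (g' - g).
  by rewrite !mulrBr addrA [h * g']mulrC subrK [h * g]mulrC.
by apply: rpredD; apply: higson0M; exact: hq_repr.
Qed.

Lemma hq_piZ c (g : B) : hq_scale c (\pi_Q g) = \pi_Q (c *: g).
Proof.
apply/higson_quotP; rewrite -scalerBr.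
pose cc : B := exist _ (cst c) (higson_pred_cst X c).
have -> (h : B) : c *: h = cc * h by exact/val_inj.
by apply: higson0M; exact: hq_repr.
Qed.

Lemma hq_mulA : associative hq_mul.
Proof.
elim/quotW=> a; elim/quotW=> b; elim/quotW=> c.
by rewrite (hq_piM b c) (hq_piM a b) (hq_piM a) hq_piM mulrA.
Qed.

Lemma hq_mulC : commutative hq_mul.
Proof. by move=> a b; rewrite /hq_mul mulrC. Qed.

Lemma hq_mul1 : left_id hq_one hq_mul.
Proof. by elim/quotW=> a; rewrite hq_piM mul1r. Qed.

Lemma hq_mulDl : left_distributive hq_mul +%R.
Proof.
elim/quotW=> a; elim/quotW=> b; elim/quotW=> c.
by rewrite -higson_piD !hq_piM -higson_piD mulrDl.
Qed.

HB.instance Definition _ := GRing.Zmodule_isComPzRing.Build Q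
  hq_mulA hq_mulC hq_mul1 hq_mulDl.

Lemma hq_scaleA a b (v : Q) : hq_scale a (hq_scale b v) = hq_scale (a * b) v.
Proof. by elim/quotW: v => v; rewrite (hq_piZ b) !hq_piZ scalerA. Qed.

Lemma hq_scale1 : left_id 1 hq_scale.
Proof. by elim/quotW=> v; rewrite hq_piZ scale1r. Qed.

Lemma hq_scaleDr : right_distributive hq_scale +%R.
Proof.
move=> a; elim/quotW=> u; elim/quotW=> v.
by rewrite -higson_piD !hq_piZ -higson_piD scalerDr.
Qed.

Lemma hq_scaleDl (v : Q) : {morph hq_scale^~ v : a b / a + b}.
Proof. by elim/quotW: v => v a b; rewrite !hq_piZ -higson_piD scalerDl. Qed.

HB.instance Definition _ := GRing.Zmodule_isLmodule.Build C Q
  hq_scaleA hq_scale1 hq_scaleDr hq_scaleDl.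

Lemma higson_piM (g h : B) : \pi_Q (g * h) = \pi_Q g * \pi_Q h.
Proof. by rewrite -hq_piM. Qed.

Lemma higson_piZ c (g : B) : \pi_Q (c *: g) = c *: \pi_Q g.
Proof. by rewrite -hq_piZ. Qed.

End QuotientAlgebra.

(* Gelfand spectrum of B_h(X)/B_0(X): its characters (unital C-algebra
   morphisms to C; these are automatically *-preserving), with the topology of
   pointwise convergence. *)
Definition characters (X : metricType R) : set {ptws higson_quot X -> C^o} :=
  [set chi | linear (chi : higson_quot X -> C) /\
             monoid_morphism (chi : higson_quot X -> C)].
#[global] Arguments characters : clear implicits.

Definition higson_corona (X : metricType R) : Type :=
  set_type (characters X).

HB.instance Definition _ (X : metricType R) :=
  Topological.copy (higson_corona X) (set_type (characters X)).

End HigsonAlgebra.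

Section InducedMap.
Context {R : realType} {X Y : metricType R}.
Local Notation C := R[i].

Lemma ls_continuousP (f : X -> Y) : ls_continuous f -> forall r : R, 0 < r ->
  exists2 s : R, 0 < s &
    forall x x', mdist x x' <= r -> mdist (f x) (f x') <= s.
Proof.
move=> fls r r0.
have [|s s0 H] := fls [set A | diam_le A r]; first by exists r.
exists s => // x x' xx'; apply: (H (f @` [set x; x'])).
- exists [set x; x'] => // a b [->|->] [->|->];
    by [rewrite mdistxx ltW|rewrite // metric_sym].
- by exists x => //; left.
- by exists x' => //; right.
Qed.

Lemma higson_pred_comp (f : X -> Y) (g : Y -> C) : coarse_map f ->
  g \in higson_pred Y -> (g \o f) \in higson_pred X.
Proof.
move=> [fls fp] /asboolP[[M gM] gs]; apply/asboolP; split.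
  by exists M => x; exact: gM.
move=> r e r0 e0; have [s s0 H] := ls_continuousP fls r0.
have [B bB HB] := gs s e s0 e0; exists (f @^-1` B); first exact: fp.
by move=> x x' xB x'B d; apply: HB => //; exact: H.
Qed.

Variables (f : X -> Y) (hf : coarse_map f).

Definition higson_pull (g : higson_fun Y) : higson_fun X :=
  exist _ (\val g \o f) (higson_pred_comp hf (valP g)).

Lemma higson0_pull (g : higson_fun Y) :
  g \in higson0 Y -> higson_pull g \in higson0 X.
Proof.
move=> /asboolP g0; apply/asboolP => e e0; have [B bB H] := g0 e e0.
by exists (f @^-1` B); [exact: hf.2|move=> x; exact: H].
Qed.

Definition higson_quot_pull (a : higson_quot Y) : higson_quot X :=
  \pi_(higson_quot X) (higson_pull (repr a)).

(* [g] |-> [g o f] *)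
Lemma higson_quot_pullE (g : higson_fun Y) :
  higson_quot_pull (\pi_(higson_quot Y) g) =
  \pi_(higson_quot X) (higson_pull g).
Proof.
apply/higson_quotP; have -> h : higson_pull h - higson_pull g =
    higson_pull (h - g) by exact/val_inj.
by apply: higson0_pull; exact: hq_repr.
Qed.

Lemma higson_quot_pull_linear : linear higson_quot_pull.
Proof.
move=> c; elim/quotW=> a; elim/quotW=> b.
rewrite -higson_piZ -higson_piD !higson_quot_pullE -higson_piZ -higson_piD.
by congr (\pi_(higson_quot X) _); exact/val_inj.
Qed.

Lemma higson_quot_pull_monoid : monoid_morphism higson_quot_pull.
Proof.
split.
  rewrite -[1]/(\pi_(higson_quot Y) 1) higson_quot_pullE.
  by congr (\pi_(higson_quot X) _); exact/val_inj.
elim/quotW=> a; elim/quotW=> b.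
rewrite -higson_piM !higson_quot_pullE -higson_piM.
by congr (\pi_(higson_quot X) _); exact/val_inj.
Qed.

Lemma characters_pull (chi : higson_corona X) :
  characters Y (\val chi \o higson_quot_pull).
Proof.
have [chiL [chi1 chiM]] := set_valP chi; split.
  by move=> c a b /=; rewrite higson_quot_pull_linear chiL.
have [p1 pM] := higson_quot_pull_monoid.
by split=> [|a b] /=; rewrite ?p1 ?pM ?chi1 ?chiM.
Qed.

Definition corona_map (chi : higson_corona X) : higson_corona Y :=
  exist (fun psi => psi \in characters Y) (\val chi \o higson_quot_pull)
    (mem_set (characters_pull chi)).

Lemma corona_map_continuous : continuous corona_map.
Proof.
apply: (@continuous_comp_initial _ (higson_corona X) _
  (set_val : characters Y -> _)) => chi.
apply/cvg_sup; first exact/fmap_filter/(nbhs_filter (chi : higson_corona X)).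
move=> a; move: chi.
apply: (@continuous_comp_initial _ (higson_corona X) _
  (fun psi => psi a)) => chi.
apply: (@continuous_comp (higson_corona X) {ptws higson_quot X -> C^o} _
  set_val (fun psi => psi (higson_quot_pull a))).
  exact: initial_continuous.
exact: proj_continuous.
Qed.

End InducedMap.

Definition light_map {S T : topologicalType} (h : S -> T) : Prop :=
  forall t : T, totally_disconnected (h @^-1` [set t]).

(* Main.v *)
Require Import Defs.
From mathcomp Require Import all_boot all_order all_algebra.
From mathcomp Require Import generic_quotient ring_quotient complex.
From mathcomp Require Import all_classical all_reals all_analysis.
From mathcomp Require Import lra.

Set Implicit Arguments.
Unset Strict Implicit.
Unset Printing Implicit Defensive.

Import Order.TTheory GRing.Theory Num.Theory.
Import numFieldNormedType.Exports.

Local Open Scope classical_set_scope.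
Local Open Scope complex_scope.
Local Open Scope ring_scope.
Local Open Scope quotient_scope.

(** If [f] is not coarsely light, some chain components [K n] of preimages of
    uniformly bounded sets have unbounded diameters.  Since [f] is coarse they
    may be taken to leave every bounded set and to contain points [x n], [y n]
    so sparse that a slowly oscillating function is 0 at every [x n] and 1 at
    every [y n].  Fix a free ultrafilter [om] on the indices.  Each ultrafilter
    [P] on [X] lying over [om] (it contains the union of the [K n], [n] in [A],
    for all [A] in [om]) defines a character of the corona, [g |-> lim_P g].
    All these characters lie in one fibre of the corona map, because [f] has
    bounded oscillation on [K n], and those of [x] and [y] differ.  Their set is
    connected: a clopen splitting would give, since no ultrafilter can be a
    limit of both sides, a subset [S] of [X] belonging to every [P] on one side
    and to no [P] on the other.  Following chains inside the [K n] one finds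
    points [w n] in [S] and [w' n] outside [S] at bounded distance; they have
    the same limit character, which would lie on both sides. *)

(** * Limits of bounded complex functions along ultrafilters *)

Section ComplexLimits.
Context {R : realType}.
Local Notation C := (R[i]^o).

Lemma normc_ge_Im (z : R[i]) : `|complex.Im z|%:C <= `|z|.
Proof.
case: z => a b; rewrite normc_def /= lecR -sqrtr_sqr ler_wsqrtr//.
by rewrite lerDr sqr_ge0.
Qed.

Lemma norm_le_ReIm (z : R[i]) :
  `|z| <= (`|complex.Re z| + `|complex.Im z|)%:C.
Proof.
case: z => a b; rewrite normc_def /= lecR.
rewrite -[leRHS]ger0_norm ?addr_ge0// -sqrtr_sqr ler_wsqrtr//.
by rewrite sqrrD !real_normK ?num_real// -addrA lerD2l lerDr mulrn_wge0 ?mulr_ge0.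
Qed.

(** A positive element of [R[i]] is real, so real tolerances suffice. *)
Lemma complex_cvgP {T : Type} {F : set_system T} {FF : Filter F}
    (g : T -> C) (l : C) :
  g @ F --> l <->
  (forall e : R, 0 < e -> F [set x | `|g x - l| <= e%:C]).
Proof.
split=> [gl e e0|H].
  have e0' : 0 < (e%:C : C) by rewrite ltcR.
  have /cvgrPdist_le /(_ _ e0') := gl.
  by apply: filterS => x /=; rewrite distrC.
apply/cvgrPdist_le => e e0.
have eR : (complex.Re e)%:C = e by apply: RRe_real; exact: gtr0_real.
have /H : 0 < complex.Re e by rewrite -ltcR eR.
by apply: filterS => x /=; rewrite eR distrC.
Qed.

(** By compactness of the segment the image of [F] clusters at some [l]. The ultrafilter contains
    each set [|g x - l| <= e] or its complement, and the complement would contradict clustering. *)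
Lemma ultra_cvg_real {T : Type} {F : set_system T} (FU : UltraFilter F)
    (g : T -> R) (M : R) : (forall x, `|g x| <= M) ->
  exists l : R, forall e, 0 < e -> F [set x | `|g x - l| <= e].
Proof.
move=> gM; have PF := @ultra_proper _ _ FU.
have : compact `[- M, M] by exact: segment_compact.
move=> /(_ (g @ F)) [|l [_]].
  apply: (@filterS _ F _ setT) => [x _ /=|]; last exact: filterT.
  by rewrite in_itv/= -ler_norml.
move=> cl; exists l => e e0.
have [//|NF] := in_ultra_setVsetC [set x | `|g x - l| <= e] FU.
have [|y [/= + ly]] := cl [set y | ~ `|y - l| <= e] (ball l e) _ (nbhsx_ballx l e e0).
  exact: NF.
by case; move: ly; rewrite -ball_normE /= distrC => /ltW.
Qed.

Lemma ultra_cvg_complex {T : Type} {F : set_system T} (FU : UltraFilter F)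
    (g : T -> C) (M : R) : (forall x, `|g x| <= M%:C) ->
  exists l : C, g @ F --> l.
Proof.
move=> gM; have PF := @ultra_proper _ _ FU.
have [|a Ha] := @ultra_cvg_real _ _ FU (fun x => complex.Re (g x)) M.
  by move=> x; rewrite -lecR (le_trans (normc_ge_Re _)).
have [|b Hb] := @ultra_cvg_real _ _ FU (fun x => complex.Im (g x)) M.
  by move=> x; rewrite -lecR (le_trans (normc_ge_Im _)).
exists (a +i* b : C); apply/complex_cvgP => e e0.
have e20 : 0 < e / 2 by rewrite divr_gt0.
apply: filterS (filterI (Ha _ e20) (Hb _ e20)) => x [/= ha hb].
apply: le_trans (norm_le_ReIm _) _.
rewrite lecR [leRHS]splitr; apply: lerD.
  by move: ha; case: (g x).
by move: hb; case: (g x).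
Qed.

Lemma complex_cvg_unique {T : Type} {F : set_system T} (PF : ProperFilter F)
    (g : T -> C) (l l' : C) : g @ F --> l -> g @ F --> l' -> l = l'.
Proof. exact: (cvg_unique (@norm_hausdorff _ C)). Qed.

End ComplexLimits.

(** * Characters of the corona given by ultrafilters *)

Section LimitCharacters.
Context {R : realType} {X : metricType R}.
Local Notation C := (R[i]^o).
Local Notation Q := (higson_quot X).

Definition escaping (P : set_system X) : Prop :=
  forall B, mbounded B -> P (~` B).

Definition limit_character (P : set_system X) (chi : higson_corona X) : Prop :=
  forall g : higson_fun X,
    (\val g : X -> C) @ P --> (\val chi (\pi_Q g) : C).

Lemma higson0_cvg {P : set_system X} {PF : ProperFilter P} :
  escaping P -> forall g : higson_fun X, g \in higson0 X -> (\val g : X -> C) @ P --> (0 : C).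
Proof.
move=> Pesc g /asboolP g0; apply/complex_cvgP => e e0.
have [B bB HB] := g0 e e0.
by apply: filterS (Pesc B bB) => x /= nBx; rewrite subr0; exact: HB.
Qed.

(** [chi] is defined through one representative of each class; another representative differs by an
    element of the ideal, which tends to 0 along an escaping filter. The algebraic laws pass to the
    limit. *)
Lemma limit_character_exists (P : set_system X) (UP : UltraFilter P) :
  escaping P -> exists chi, limit_character P chi.
Proof.
move=> Pesc; have PP := @ultra_proper _ _ UP.
have lim_ex (a : Q) : exists l : C, (\val (repr a) : X -> C) @ P --> l.
  have /asboolP[[M gM] _] := valP (repr a).
  exact: ultra_cvg_complex gM.
have [chi chiP] := choice lim_ex.
have chi_pi (g : higson_fun X) : (\val g : X -> C) @ P --> (chi (\pi_Q g) : C).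
  have -> : (\val g : X -> C) = (fun x => \val (repr (\pi_Q g)) x -
      \val (repr (\pi_Q g) - g) x).
    apply/funext => x; rewrite -[X in _ - X]/(\val (repr (\pi_Q g)) x - \val g x).
    by rewrite opprB addrC subrK.
  rewrite -[chi _]subr0; apply: cvgB; first exact: chiP.
  by apply: higson0_cvg; last exact: hq_repr.
have chiC : characters X chi.
  split; [|split].
  - move=> c; elim/quotW=> g; elim/quotW=> h.
    rewrite -higson_piZ -higson_piD.
    apply: (complex_cvg_unique PP (chi_pi _)).
    apply: cvgD; last exact: chi_pi.
    apply: (@cvgM R[i] _ _ _ (fun=> c) (\val g)); last exact: chi_pi.
    exact: cvg_cst.
  - rewrite -[1]/(\pi_Q 1).
    apply: (complex_cvg_unique PP (chi_pi _)); exact: cvg_cst.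
  - elim/quotW=> g; elim/quotW=> h; rewrite -higson_piM.
    apply: (complex_cvg_unique PP (chi_pi _)).
    by apply: cvgM; exact: chi_pi.
by exists (exist _ chi (mem_set chiC)).
Qed.

End LimitCharacters.

(** * Separation of filters, and exits from a set along a sequence *)

(** Without a separating [S], every member of [F] meets every member of [G]; the intersections
    generate a proper filter, which extends to an ultrafilter. *)
Lemma filters_separate_or_compatible {T : Type} (F G : set_system T)
    (FF : Filter F) (GF : Filter G) :
  (exists2 S, F S & G (~` S)) \/
  (exists H, [/\ UltraFilter H, F `<=` H & G `<=` H]).
Proof.
have [|sep] := pselect (exists2 S, F S & G (~` S)); [by left|right].
pose J : set_system T := filter_from [set p : set T * set T | F p.1 /\ G p.2]
  (fun p => p.1 `&` p.2).
have JF : ProperFilter J.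
  apply: filter_from_proper.
    apply: filter_from_filter.
      by exists (setT, setT); split => /=; exact: filterT.
    move=> [A B] [A' B'] /= [FA GB] [FA' GB'].
    exists (A `&` A', B `&` B') => /=; first by split; exact: filterI.
    by move=> x [[? ?] [? ?]].
  move=> [A B] /= [FA GB]; apply: contrapT => AB; apply: sep; exists A => //.
  by apply: filterS GB => x Bx Ax; apply: AB; exists x.
have [H [UH JH]] := ultraFilterLemma JF.
exists H; split=> // S HS; apply: JH.
  by exists (S, setT) => /= [|x []//]; split=> //; exact: filterT.
by exists (setT, S) => /= [|x []//]; split=> //; exact: filterT.
Qed.

Lemma exit_index {T : Type} (S : set T) (s : nat -> T) (k : nat) :
  S (s 0%N) -> ~ S (s k) -> exists i, [/\ (i < k)%N, S (s i) & ~ S (s i.+1)].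
Proof.
elim: k => [//|k IH] S0 nSk.
have [Sk|nS] := pselect (S (s k)); first by exists k.
by have [i [ik ? ?]] := IH S0 nS; exists i; split=> //; exact: ltnW.
Qed.

(** * Convergence in the corona *)

Section CoronaLimits.
Context {R : realType} {X : metricType R}.
Local Notation C := (R[i]^o).
Local Notation Q := (higson_quot X).

Lemma corona_cvgP (F : set_system (higson_corona X)) (FF : Filter F)
    (chi : higson_corona X) :
  (forall a : Q, (fun psi : higson_corona X => \val psi a : C) @ F -->
     (\val chi a : C)) -> F --> chi.
Proof.
move=> H U [/= _ [[W oW <-] Wchi]] /filterS; apply.
suff : ((fun psi : higson_corona X => \val psi) @ F) -->
    (\val chi : {ptws Q -> C}).
  by move=> /(_ W); apply; exact: open_nbhs_nbhs.
apply/cvg_sup => a V [/= _ [[W' oW' <-] W'chi]] /filterS; apply.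
by apply: (H a); exact: open_nbhs_nbhs.
Qed.

(** For [S] in [q], take the characters in [D] of those [P] that contain [S]. These sets generate a
    filter converging to [chi]: if [S] is the set where [g] is [e / 2]-close to its limit along [q],
    its limit along any such [P] is [e]-close to that one. *)
Lemma closed_limit_character (D : set (higson_corona X))
    (PP : set (set_system X)) (q : set_system X) (chi : higson_corona X) :
  closed D ->
  (forall P, PP P -> ProperFilter P /\
     exists2 psi, limit_character P psi & D psi) ->
  ProperFilter q -> limit_character q chi ->
  (forall S, q S -> exists2 P, PP P & P S) ->
  D chi.
Proof.
move=> cD hPP qF qchi qPP.
pose G := filter_from q (fun S => [set psi | exists P,
  [/\ PP P, P S, limit_character P psi & D psi]]).
have GF : ProperFilter G.
  apply: filter_from_proper.
    apply: filter_from_filter; first by exists setT; exact: filterT.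
    move=> S S' qS qS'; exists (S `&` S'); first exact: filterI.
    move=> psi [P [pP PSS' pchi Dpsi]]; have [PF _] := hPP P pP.
    by split; exists P; split=> //; apply: filterS PSS' => x [].
  move=> S /qPP[P pP PS]; have [_ [psi ? ?]] := hPP P pP.
  by exists psi, P.
apply: (@closed_cvg _ _ G _ id D cD).
  exists setT; first exact: filterT.
  by move=> psi [P []].
apply: corona_cvgP; elim/quotW=> g; apply/complex_cvgP => e e0.
have e20 : 0 < e / 2 by rewrite divr_gt0.
have /complex_cvgP/(_ _ e20) qS := qchi g.
exists [set x | `|(\val g x : C) - (\val chi (\pi_Q g))| <= (e / 2)%:C] => //.
move=> psi [P [pP PS Ppsi _]] /=; have [PF _] := hPP P pP.
have /complex_cvgP/(_ _ e20) PS' := Ppsi g.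
have [x [/= x1 x2]] := filter_ex (filterI PS PS').
rewrite [e]splitr rmorphD /=.
apply: le_trans (lerD x2 x1); rewrite [X in _ <= X + _]distrC.
by apply: le_trans (ler_normD _ _); rewrite addrA subrK.
Qed.

End CoronaLimits.

(** * The limit set of an escaping sequence of sets, and its connectedness *)

Section LimitSet.
Context {R : realType} {X : metricType R}.
Local Notation C := (R[i]^o).
Variables (om : set_system nat) (K : nat -> set X).
Hypothesis Uom : UltraFilter om.
Hypothesis om_free : forall N, om [set n | (N <= n)%N].
Hypothesis K_escapes : forall B, mbounded B ->
  exists N, forall n x, (N <= n)%N -> K n x -> ~ B x.

Let om_proper : ProperFilter om := @ultra_proper _ _ Uom.

(** As the [K n] may overlap, this is phrased through unions rather than through an index map on
    [X]. *)
Definition lies_over (P : set_system X) : Prop :=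
  forall A, om A -> P (\bigcup_(n in A) K n).

Definition limit_set : set (higson_corona X) :=
  [set chi | exists P, [/\ UltraFilter P, lies_over P & limit_character P chi]].

Lemma lies_over_escaping (P : set_system X) (FP : Filter P) :
  lies_over P -> escaping P.
Proof.
have omF : Filter om := @filter_filter _ _ om_proper.
move=> oP B /K_escapes[N HN].
by apply: filterS (oP _ (om_free N)) => x [n /= Nn]; exact: HN.
Qed.

(** [P] extends the image of [om] under [w]. The limit of [g (w n)] along [om] exists by
    boundedness, and must then be the limit of [g] along [P]. *)
Lemma selection_limit (w : nat -> X) : om [set n | K n (w n)] ->
  exists P chi, [/\ UltraFilter P, lies_over P,
    (forall S, om (w @^-1` S) -> P S), limit_character P chi & forall g : higson_fun X,
      ((fun n => \val g (w n)) : nat -> C) @ om --> (\val chi (\pi_(higson_quot X) g) : C)].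
Proof.
have omF : Filter om := @filter_filter _ _ om_proper.
move=> Kw; have [P [UP wP]] := ultraFilterLemma (fmap_proper_filter w om_proper).
have PP := @ultra_proper _ _ UP.
have wF S : om (w @^-1` S) -> P S by exact: wP.
have oP : lies_over P.
  move=> A omA; apply: wF; apply: filterS (filterI omA Kw) => n [An Kn].
  by exists n.
have [chi Pchi] := limit_character_exists UP (lies_over_escaping PP oP).
exists P, chi; split=> // g.
have /asboolP[[M gM] _] := valP g.
have [|l hl] := @ultra_cvg_complex _ _ _ Uom (fun n => \val g (w n)) M.
  by move=> n; exact: gM.
suff <- : l = \val chi (\pi_(higson_quot X) g) by [].
apply: (complex_cvg_unique PP _ (Pchi g)).
by move=> U /hl omU; apply: wP.
Qed.

(** At scale [r], [g] oscillates little outside a bounded set, which the [K n] avoid for large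
    [n]. *)
Lemma close_selections_limit (w w' : nat -> X) (r : R) (chi chi' : higson_corona X) :
  om [set n | K n (w n)] -> om [set n | K n (w' n)] ->
  0 < r -> om [set n | mdist (w n) (w' n) <= r] ->
  (forall g : higson_fun X, ((fun n => \val g (w n)) : nat -> C) @ om -->
     (\val chi (\pi_(higson_quot X) g) : C)) ->
  (forall g : higson_fun X, ((fun n => \val g (w' n)) : nat -> C) @ om -->
     (\val chi' (\pi_(higson_quot X) g) : C)) ->
  chi = chi'.
Proof.
have omF : Filter om := @filter_filter _ _ om_proper.
move=> Kw Kw' r0 ww' wchi w'chi'; apply/val_inj/funext; elim/quotW=> g.
apply: (complex_cvg_unique om_proper (wchi g)); apply/complex_cvgP => e e0.
have e20 : 0 < e / 2 by rewrite divr_gt0.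
have /asboolP[_ /(_ _ _ r0 e20)[B /K_escapes[N HN] gB]] := valP g.
have /complex_cvgP/(_ _ e20) w'e := w'chi' g.
apply: filterS (filterI (filterI (filterI Kw Kw') (filterI (om_free N) ww')) w'e)
  => n [/= [[Kn Kn'] [Nn dn]] le].
rewrite [e]splitr rmorphD /=; apply: le_trans (lerD (gB _ _ _ _ dn) le).
- by apply: le_trans (ler_normD _ _); rewrite addrA subrK.
- exact: HN Kn.
- exact: HN Kn'.
Qed.

(** Otherwise [P] would contain the union of the [K n] that miss [S], a set disjoint from [S]. *)
Lemma lies_over_meets (P : set_system X) (S : set X) : ProperFilter P ->
  lies_over P -> P S -> om [set n | exists2 x, K n x & S x].
Proof.
have omF : Filter om := @filter_filter _ _ om_proper.
move=> PF oP PS; have [//|nA] := in_ultra_setVsetC [set n | exists2 x, K n x & S x] Uom.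
have [x [Sx [n nn Knx]]] := filter_ex (filterI PS (oP _ nA)).
by case: nn; exists x.
Qed.

Lemma limit_set_connected (r : R) : 0 < r ->
  (forall n x x', K n x -> K n x' -> exists k (s : nat -> X),
    [/\ s 0%N = x, s k = x', (forall i, (i <= k)%N -> K n (s i)) &
        (forall i, (i < k)%N -> mdist (s i) (s i.+1) <= r)]) ->
  connected limit_set.
Proof.
have omF : Filter om := @filter_filter _ _ om_proper.
move=> r0 chain B [chi0 Bchi0] [V oV BV] [D cD BD].
apply: contrapT => BL.
have BsubL : B `<=` limit_set by rewrite BV => chi [].
have [chi1 [Lchi1 nBchi1]] : exists chi, limit_set chi /\ ~ B chi.
  apply: contrapT => nE; apply: BL; apply/seteqP; split=> // chi Lchi.
  by apply: contrapT => nB; apply: nE; exists chi.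
(* Within the limit set, [D] cuts out [B] and the complement of [V] cuts out the rest. Both are
   closed, so the ultrafilters on the two sides can be treated alike. *)
pose over_in (D : set (higson_corona X)) : set (set_system X) := [set P |
  [/\ UltraFilter P, lies_over P & exists2 chi, limit_character P chi & D chi]].
have over_inF E : Filter (\bigcap_(P in over_in E) P).
  split=> [P [UP _ _]|S S' FS FS' P PE|S S' SS' FS P PE].
  - by have PP := @ultra_proper _ _ UP; exact: filterT.
  - have [UP _ _] := PE; have := @ultra_proper _ _ UP => PP.
    by apply: filterI; [exact: FS|exact: FS'].
  - have [UP _ _] := PE; have := @ultra_proper _ _ UP => PP.
    by apply: filterS SS' _; exact: FS.
(* If some [S] in [q] belonged to no ultrafilter of the family, its complement would belong to all
   of them, hence to [q]. *)
have closed_over E (q : set_system X) chi : closed E -> UltraFilter q ->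
    \bigcap_(P in over_in E) P `<=` q -> limit_character q chi -> E chi.
  move=> cE Uq Eq qchi; have qP := @ultra_proper _ _ Uq.
  apply: (@closed_limit_character _ _ E (over_in E) q) => //.
    by move=> P [UP _ HP]; split=> //; exact: ultra_proper.
  move=> S qS; apply: contrapT => nS.
  suff /Eq qnS : (\bigcap_(P in over_in E) P) (~` S).
    by have [x []] := filter_ex (filterI qS qnS).
  move=> P PE; have [UP _ _] := PE.
  by have [PS|//] := in_ultra_setVsetC S UP; case: nS; exists P.
have BDE chi : limit_set chi -> B chi <-> D chi.
  by rewrite BD => Lchi; split=> [[]|].
have BVE chi : limit_set chi -> B chi <-> V chi.
  by rewrite BV => Lchi; split=> [[]|].
(* Each of the two filters consists of the sets common to all ultrafilters on one side. *)
have [] := filters_separate_or_compatible (over_inF D) (over_inF (~` V)).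
  move=> [S DS nVS].
  have [P0 [UP0 oP0 P0chi]] := BsubL _ Bchi0.
  have [P1 [UP1 oP1 P1chi]] := Lchi1.
  have PP0 := @ultra_proper _ _ UP0; have PP1 := @ultra_proper _ _ UP1.
  have P0S : P0 S.
    apply: DS; split; [exact: UP0|exact: oP0|exists chi0; first exact: P0chi].
    exact: (BDE _ (BsubL _ Bchi0)).1.
  have P1S : P1 (~` S).
    apply: nVS; split; [exact: UP1|exact: oP1|exists chi1; first exact: P1chi].
    by move=> /(BVE _ Lchi1).
  have [x0 _] := filter_ex P0S.
  (* Where [K n] meets both [S] and its complement, some step of a chain leaves [S]; for the other
     [n] the pair is the dummy [(x0, x0)]. *)
  have /choice[w wP] : forall n, exists p : X * X,
      (exists2 x, K n x & S x) -> (exists2 x, K n x & (~` S) x) ->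
      [/\ K n p.1, K n p.2, S p.1, ~ S p.2 & mdist p.1 p.2 <= r].
    move=> n; have [[[x Kx Sx] [x' Kx' Sx']]|nE] :=
        pselect ((exists2 x, K n x & S x) /\ (exists2 x, K n x & (~` S) x)).
      have [k [s [s0 sk sK sr]]] := chain n x x' Kx Kx'.
      have [||i [ik Si nSi]] := @exit_index _ S s k; rewrite ?s0 ?sk//.
      by exists (s i, s i.+1) => _ _; split=> //=; [exact/sK/ltnW|exact: sK|exact: sr].
    by exists (x0, x0) => ? ?; case: nE.
  have omw := @filterI _ om omF _ _ (lies_over_meets PP0 oP0 P0S)
    (lies_over_meets PP1 oP1 P1S).
  have omw1 : om [set n | K n (w n).1].
    by apply: filterS omw => n [/wP /[apply] -[]].
  have omw2 : om [set n | K n (w n).2].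
    by apply: filterS omw => n [/wP /[apply] -[]].
  (* The two selections are [r]-close, so their characters coincide; yet [S] puts the first in [B]
     and the complement of [S] keeps the second out of [B]. *)
  have [P [chi [UP oP wP' Pchi chilim]]] := selection_limit omw1.
  have [P' [chi' [UP' oP' wP'' Pchi' chilim']]] := selection_limit omw2.
  have PP := @ultra_proper _ _ UP; have PP' := @ultra_proper _ _ UP'.
  have PS : P S.
    by apply: wP'; apply: filterS omw => n [/wP /[apply] -[]].
  have PS' : P' (~` S).
    by apply: wP''; apply: filterS omw => n [/wP /[apply] -[]].
  have chichi' : chi = chi'.
    apply: (close_selections_limit omw1 omw2 r0 _ chilim chilim').
    by apply: filterS omw => n [/wP /[apply] -[]].
  have Lchi : limit_set chi by exists P.
  have Lchi' : limit_set chi' by exists P'.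
  have Bchi : B chi.
    apply/(BVE _ Lchi); apply: contrapT => nV.
    have PnS : P (~` S).
      by apply: nVS; split; [exact: UP|exact: oP|exists chi].
    by have [x []] := filter_ex (filterI PS PnS).
  have nBchi' : ~ B chi'.
    move=> /(BDE _ Lchi') Dchi'.
    have P'S : P' S by apply: DS; split; [exact: UP'|exact: oP'|exists chi'].
    by have [x []] := filter_ex (filterI P'S PS').
  by apply: nBchi'; rewrite -chichi'.
(* An ultrafilter finer than both filters has its limit character in both closed sets, that is, on
   both sides. *)
move=> [q [Uq Dq nVq]]; have qP := @ultra_proper _ _ Uq.
have oq : lies_over q by move=> A omA; apply: Dq => P [_ oP _]; exact: oP.
have [chi qchi] := limit_character_exists Uq (lies_over_escaping qP oq).
have Lchi : limit_set chi by exists q.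
have Dchi : D chi by exact: (closed_over D q).
have nVchi : (~` V) chi.
  by apply: (closed_over (~` V) q) => //; exact: open_closedC.
by apply: nVchi; apply/(BVE _ Lchi)/(BDE _ Lchi).
Qed.

End LimitSet.

(** * Chain components and a criterion for coarse lightness *)

Section ChainComponents.
Context {R : realType} {X : metricType R}.
Variables (U : set (set X)) (A : set X).

Lemma chained_sym x x' : chained U A x x' -> chained U A x' x.
Proof.
move=> [k [s [s0 sk sA sU]]]; exists k, (fun i => s (k - i)%N).
rewrite subn0 subnn; split=> // i ik; first by apply: sA; exact: leq_subr.
have kik : (k - i.+1 < k)%N by rewrite ltn_subrL; case: k ik {s0 sk sA sU}.
have [W UW [W1 W2]] := sU (k - i.+1)%N kik.
by exists W => //; rewrite subnSK in W2.
Qed.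

Lemma chained_trans x y z : chained U A x y -> chained U A y z -> chained U A x z.
Proof.
move=> [k [s [s0 sk sA sU]]] [l [t [t0 tl tA tU]]].
exists (k + l)%N, (fun i => if (i <= k)%N then s i else t (i - k)%N).
split=> [//||i ikl|i ikl].
- case: leqP => [|_]; last by rewrite addKn.
  by rewrite -[leqRHS]addn0 leq_add2l leqn0 => /eqP l0; rewrite l0 addn0 sk -t0 -tl l0.
- by case: leqP => [|ki]; [exact: sA|apply: tA; rewrite leq_subLR].
- case: (ltngtP i k) => [ik|ki|ik].
  + exact: sU.
  + by rewrite subSn ?(ltnW ki)//; apply: tU; rewrite ltn_subLR// ltnW.
  + rewrite ik subSn// subnn sk -t0; apply: tU.
    by move: ikl; rewrite ik -[X in (X < _)%N]addn0 ltn_add2l.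
Qed.

(** The chain runs from [x] back to [c] and on to [x']; it stays in the component because its
    initial segments join each of its points to [x]. *)
Lemma component_chain c x x' : chained U A c x -> chained U A c x' ->
  exists k (s : nat -> X), [/\ s 0%N = x, s k = x',
    (forall i, (i <= k)%N -> chained U A c (s i)) &
    (forall i, (i < k)%N -> exists2 V, U V & V (s i) /\ V (s i.+1))].
Proof.
move=> cx cx'; have [k [s [s0 sk sA sU]]] := chained_trans (chained_sym cx) cx'.
exists k, s; split=> // i ik; apply: chained_trans cx _.
exists i, s; split=> // j ji; first by apply: sA; exact: leq_trans ik.
by apply: sU; exact: leq_trans ik.
Qed.

Lemma component_sub c x : chained U A c x -> A x.
Proof. by move=> [k [s [_ <- sA _]]]; exact: sA. Qed.

End ChainComponents.

Lemma coarsely_lightP {R : realType} {X Y : metricType R} (f : X -> Y) :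
  ls_continuous f ->
  (forall U V, uniformly_bounded U -> uniformly_bounded V ->
     uniformly_bounded (component_family U f V)) ->
  coarsely_light f.
Proof.
move=> fls H; apply/seteqP; split=> W.
  move=> [U [V [Ub Vb WUV]]]; have [M M0 HM] := H U V Ub Vb.
  exists M => // A WA x y Ax Ay; have [->|xy] := pselect (x = y).
    by rewrite mdistxx ltW.
  have [|C UVC AC] := WUV A WA; first by exists x, y.
  by apply: (HM C UVC); exact: AC.
(* Each [A] in [W] lies in a single [W]-component of the preimage of its image, by chains of one
   step. *)
move=> Wb; exists W, [set f @` A | A in W]; split=> //; first exact: fls.
move=> A WA [x [_ [Ax _ _]]]; exists (chained W (f @^-1` (f @` A)) x).
  exists (f @` A); first by exists A.
  by exists x => //; exists x.
move=> y Ay; exists 1%N, (fun i => if i is 0%N then x else y).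
split=> // [[|i] _|[|i]//]; first by exists x.
  by exists y.
by move=> _; exists A.
Qed.

(** * Sparse sequences and slowly oscillating functions separating them *)

Section Separation.
Context {R : realType} {X : metricType R}.

Lemma mbounded_ball (a : X) (r : R) : mbounded [set z | mdist a z <= r].
Proof.
exists (r + r) => x y /= ax ay; apply: le_trans (metric_triangle x a y) _.
by apply: lerD; rewrite // metric_sym.
Qed.

Lemma mbounded_balls (x : nat -> X) (r : nat -> R) (k : nat) :
  mbounded [set z | exists2 n, (n < k)%N & mdist (x n) z <= r n].
Proof.
elim: k => [|k IH]; first by exists 0 => ? ? [].
have [M HM] := mboundedU IH (mbounded_ball (x k) (r k)).
have sub z : (exists2 n, (n < k.+1)%N & mdist (x n) z <= r n) ->
    (exists2 n, (n < k)%N & mdist (x n) z <= r n) \/ mdist (x k) z <= r k.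
  move=> [n + zn]; rewrite ltnS leq_eqVlt => /predU1P[nk|nk].
    by right; rewrite -nk.
  by left; exists n.
by exists M => z z' /sub zk /sub z'k; exact: HM.
Qed.

(* The witness is [z |-> inf_n min 1 (d (x n) z / (n + 1))]: the [n]-th term has
   Lipschitz constant [1 / (n + 1)] and is 1 outside a bounded set, so only
   finitely many terms oscillate by more than [e], and these only nearby. *)
Lemma higson_separation (x y : nat -> X) :
  (forall n m, n.+1%:R <= mdist (x n) (y m)) ->
  exists g : higson_fun X,
    (forall n, \val g (x n) = 0) /\ (forall n, \val g (y n) = 1).
Proof.
move=> xy.
pose t (z : X) (n : nat) : R := Num.min 1 (mdist (x n) z / n.+1%:R).
pose h z := inf (range (t z)).
have t0 z n : 0 <= t z n by rewrite le_min ler01 divr_ge0 ?mdist_ge0.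
have ht z n : h z <= t z n.
  apply: ge_inf; last by exists n.
  by exists 0 => _ [m _ <-].
have hge z e : (forall n, e <= t z n) -> e <= h z.
  move=> et; apply: lb_le_inf; first by exists (t z 0%N), 0%N.
  by move=> _ [n _ <-].
have h0 z : 0 <= h z by exact: hge.
have h1 z : h z <= 1 by rewrite (le_trans (ht z 0%N))// ge_min lexx.
have hx n : h (x n) = 0.
  apply/eqP; rewrite eq_le h0 andbT; apply: le_trans (ht _ n) _.
  by rewrite /t mdistxx mul0r ge_min lexx orbT.
have hy n : h (y n) = 1.
  apply/eqP; rewrite eq_le h1 andTb; apply: hge => m.
  by rewrite /t le_min lexx/= ler_pdivlMr// mul1r xy.
pose g : X -> R[i] := fun z => (h z)%:C.
have gX : g \in higson_pred X.
  apply/asboolP; split.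
    by exists 1 => z; rewrite /g normc_def /= expr0n addr0 sqrtr_sqr lecR ger0_norm.
  (* For [n >= k] one has [r / (n + 1) <= e]; the terms with [n < k] equal 1 off the excluded
     balls. *)
  move=> r e r0 e0; pose k := Num.bound (r / e).
  exists [set z | exists2 n, (n < k)%N & mdist (x n) z <= n.+1%:R].
    exact: mbounded_balls.
  (* A one-sided estimate; exchanging [z] and [z'] gives the other side. *)
  have key z z' : ~ (exists2 n, (n < k)%N & mdist (x n) z' <= n.+1%:R) ->
      mdist z z' <= r -> h z - e <= h z'.
    move=> nz' zz'; apply: hge => n.
    have [nk|kn] := ltnP n k.
      have tz' : t z' n = 1.
        apply/min_idPl; rewrite ler_pdivlMr// mul1r ltW// ltNge.
        by apply/negP => ?; apply: nz'; exists n.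
      by rewrite tz' lerBlDr (le_trans (h1 z))// lerDl ltW.
    rewrite lerBlDr; apply: le_trans (ht z n) _.
    have re : r / n.+1%:R <= e.
      rewrite ler_pdivrMr// mulrC -ler_pdivrMr//.
      have := archi_boundP (divr_ge0 (ltW r0) (ltW e0)) => /ltW/le_trans; apply.
      by rewrite ler_nat ltnW.
    rewrite /t addr_minl le_min; apply/andP; split.
      by rewrite ge_min lerDl ltW.
    rewrite ge_min; apply/orP; right.
    apply: (@le_trans _ _ ((mdist (x n) z' + r) / n.+1%:R)).
      rewrite ler_wpM2r ?invr_ge0//; apply: le_trans (metric_triangle _ z' _) _.
      by rewrite lerD2l metric_sym.
    by rewrite mulrDl lerD2l.
  move=> z z' nz nz' zz'.
  rewrite /g -rmorphB /= normc_def /= expr0n addr0 sqrtr_sqr lecR ler_distlC.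
  apply/andP; split; first exact: key.
  by rewrite -lerBlDr; apply: key; rewrite // metric_sym.
exists (exist _ g gX); split=> n /=; first by rewrite /g hx.
by rewrite /g hy.
Qed.

Lemma separated_sequence (F : set (set X)) (a : X) :
  (forall N : R, exists C x y, [/\ F C, C x, C y, N < mdist x y &
     forall z, C z -> N < mdist a z]) ->
  exists (K : nat -> set X) (x y : nat -> X),
    [/\ forall n, F (K n), forall n, K n (x n), forall n, K n (y n),
      forall n z, K n z -> n%:R < mdist a z &
      forall n m, n.+1%:R <= mdist (x n) (y m)].
Proof.
move=> H.
have /choice[c cP] : forall N : R, exists p : set X * X * X,
    [/\ F p.1.1, p.1.1 p.1.2, p.1.1 p.2, N < mdist p.1.2 p.2 &
     forall z, p.1.1 z -> N < mdist a z].
  by move=> N; have [C [x [y HC]]] := H N; exists (C, x, y).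
(* Each threshold exceeds the previous one by 2 plus the distances from [a] to the two points just
   chosen. Hence [N n >= 2 n + 1], and later sets are far from all earlier points. *)
pose step N := N + (mdist a (c N).1.2 + mdist a (c N).2 + 2).
pose N n := iter n step 1.
pose x n := (c (N n)).1.2; pose y n := (c (N n)).2.
have NS n : N n.+1 = N n + (mdist a (x n) + mdist a (y n) + 2) by [].
have x0 n : 0 <= mdist a (x n) := mdist_ge0 _ _.
have y0 n : 0 <= mdist a (y n) := mdist_ge0 _ _.
have Nn n : n.+1%:R + n%:R <= N n.
  elim: n => [|n IH]; first by rewrite addr0.
  rewrite NS; have := x0 n; have := y0 n; move: IH; rewrite -!natr1; lra.
have Nmn m n : (m < n)%N ->
    mdist a (x m) + mdist a (y m) + n.+1%:R + n%:R <= N n.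
  elim: n => [//|n IH]; rewrite ltnS leq_eqVlt => /predU1P[->|mn].
    by rewrite NS; have := Nn n; rewrite -!natr1; lra.
  by rewrite NS; have := IH mn; have := x0 n; have := y0 n; rewrite -!natr1; lra.
exists (fun n => (c (N n)).1.1), x, y; split=> [n|n|n|n z Kz|n m].
- by have [] := cP (N n).
- by have [] := cP (N n).
- by have [] := cP (N n).
- have [_ _ _ _ /(_ z Kz)] := cP (N n); apply: le_lt_trans.
  by apply: le_trans (Nn n); rewrite lerDr.
- have [_ Kx _ _ Kesc] := cP (N n); have Nx := Kesc _ Kx.
  have [_ _ Ky dxy Kesc'] := cP (N m); have Ny := Kesc' _ Ky.
  have n0 : 0 <= n%:R :> R by [].
  (* For distinct indices, the point of larger index is farther from [a] than its threshold, which
     dominates the distance from [a] to the other point; for equal indices the threshold bounds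
     [mdist (x n) (y n)] directly. *)
  case: (ltngtP m n) => [mn|nm|mn].
  + have := metric_triangle a (y m) (x n); rewrite [mdist (y m) _]metric_sym.
    by have := Nmn _ _ mn; have := x0 m; move: Nx; rewrite -/(x n); lra.
  + have := metric_triangle a (x n) (y m).
    have := Nmn _ _ nm; have := y0 n; move: Ny; rewrite -/(y m).
    have : n.+1%:R <= m.+1%:R :> R by rewrite ler_nat ltnW.
    by have : 0 <= m%:R :> R by []; lra.
  + by move: dxy; rewrite mn -/(x n) -/(y n); have := Nn n; lra.
Qed.

End Separation.

(** * The limit set inside one fibre, and the conclusion *)

(** On [K n] the map [f] varies by at most [M], so for large [n] the function [g o f] is nearly
    constant there, close to its value at [w n]. Its limit along any [P] over [om] is thus its limit
    along [w]. *)
Lemma limit_set_fibre {R : realType} {X Y : metricType R} (f : X -> Y)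
    (hf : coarse_map f) (om : set_system nat) (K : nat -> set X) (M : R)
    (w : nat -> X) (chi chi' : higson_corona X) :
  UltraFilter om -> (forall N, om [set n | (N <= n)%N]) ->
  (forall B, mbounded B -> exists N, forall n x, (N <= n)%N -> K n x -> ~ B x) ->
  0 < M -> (forall n x x', K n x -> K n x' -> mdist (f x) (f x') <= M) ->
  (forall n, K n (w n)) ->
  (forall g : higson_fun X, ((fun n => \val g (w n)) : nat -> R[i]^o) @ om -->
     (\val chi (\pi_(higson_quot X) g) : R[i]^o)) ->
  limit_set om K chi' -> corona_map hf chi' = corona_map hf chi.
Proof.
move=> Uom om_free K_esc M0 KM Kw wchi [P [UP oP Pchi']].
have omF : ProperFilter om by exact: ultra_proper.
have PF : ProperFilter P by exact: ultra_proper.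
apply/val_inj/funext; elim/quotW=> g /=; rewrite higson_quot_pullE.
apply: (complex_cvg_unique PF (Pchi' (higson_pull hf g))).
apply/complex_cvgP => e e0.
have e20 : 0 < e / 2 by rewrite divr_gt0.
have /asboolP[_ /(_ _ _ M0 e20)[B bB gB]] := valP g.
have [N HN] := K_esc _ (hf.2 B bB).
have /complex_cvgP/(_ _ e20) we := wchi (higson_pull hf g).
apply: filterS (oP _ (filterI (om_free N) we)) => x [n [/= Nn le] Kx].
rewrite [e]splitr rmorphD /=.
apply: le_trans (lerD (gB (f x) (f (w n)) _ _ (KM _ _ _ Kx (Kw n))) le).
- by apply: le_trans (ler_normD _ _); rewrite addrA subrK.
- exact: HN Kx.
- exact: HN (Kw n).
Qed.

Theorem proposition8p9 (R : realType) (X Y : metricType R)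
    (hX : proper_space X) (hY : proper_space Y)
    (f : X -> Y) (hf : coarse_map f) :
  light_map (corona_map hf) -> coarsely_light f.
Proof.
move=> f_light; apply: (coarsely_lightP hf.1) => U V [r r0 Ur] [M M0 VM].
apply: contrapT => unbounded.
have far N : exists A x x', [/\ component_family U f V A, A x, A x' & N < mdist x x'].
  apply: contrapT => nfar; apply: unbounded; exists (Num.max 1 N).
    by rewrite lt_max ltr01.
  move=> A cA x x' Ax Ax'; rewrite le_max; apply/orP; right.
  by rewrite leNgt; apply/negP => Nx; apply: nfar; exists A, x, x'.
have [_ [a _]] := far 0.
have fM A x x' : component_family U f V A -> A x -> A x' -> mdist (f x) (f x') <= M.
  move=> [B VB [c Bc <-]] /component_sub Bx /component_sub Bx'.
  exact: (VM B).
(* A component meeting the [N]-ball at [a] has its image within [s + M] of [f a]. It then lies in a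
   bounded preimage, of diameter at most [M'], so diameter above [M'] excludes this. *)
have farther N : exists A x x', [/\ component_family U f V A, A x, A x',
    N < mdist x x' & forall z, A z -> N < mdist a z].
  have [s s0 fs] := ls_continuousP hf.1 (ltr_pwDl ltr01 (normr_ge0 N)).
  have [M' HM'] := hf.2 _ (mbounded_ball (f a) (s + M)).
  have [A [x [x' [cA Ax Ax' dx]]]] := far (Num.max N M').
  move: dx; rewrite gt_max => /andP[Nx M'x].
  exists A, x, x'; split=> // z Az; rewrite ltNge; apply/negP => az.
  have fz : mdist (f a) (f z) <= s.
    by apply: fs; apply: le_trans az _; rewrite (le_trans (ler_norm _))// lerDr.
  have fA y : A y -> mdist (f a) (f y) <= s + M.
    move=> Ay; apply: le_trans (metric_triangle _ (f z) _) _.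
    by apply: lerD => //; exact: fM Ay.
  by move: M'x; rewrite ltNge => /negP; apply; apply: HM'; exact: fA.
have [K [x [y [cK Kx Ky Ka xy]]]] := separated_sequence farther.
have [om [Uom om_oo]] := ultraFilterLemma eventually_filter.
have omF : ProperFilter om by exact: ultra_proper.
have om_free N : om [set n | (N <= n)%N] by apply: om_oo; exact: nbhs_infty_ge.
have K_escapes B : mbounded B ->
    exists N, forall n z, (N <= n)%N -> K n z -> ~ B z.
  (* Adjoining the ball of radius 0 at [a] makes [D] bound the distances from [a] to [B]. *)
  move=> /(mboundedU (mbounded_ball a 0))[D HD]; exists (Num.bound `|D|) => n z Dn Kz Bz.
  have : mdist a z <= D by apply: HD; [left; rewrite /= mdistxx|right].
  apply/negP; rewrite -ltNge; apply: lt_trans (Ka _ _ Kz).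
  apply: le_lt_trans (ler_norm _) _; apply: lt_le_trans (archi_boundP _) _ => //.
  by rewrite ler_nat.
have Kchain n z z' : K n z -> K n z' -> exists k (s : nat -> X),
    [/\ s 0%N = z, s k = z', (forall i, (i <= k)%N -> K n (s i)) &
        (forall i, (i < k)%N -> mdist (s i) (s i.+1) <= r)].
  have [B VB [c Bc <-]] := cK n => cz cz'.
  have [k [s [s0 sk sK sU]]] := component_chain cz cz'.
  by exists k, s; split=> // i /sU[W UW [W1 W2]]; exact: (Ur W).
have omK w : (forall n, K n (w n)) -> om [set n | K n (w n)].
  by move=> Kw; apply: filterS (om_free 0%N) => n _; exact: Kw.
have [P [chix [UP oP _ Px xlim]]] := selection_limit Uom om_free K_escapes (omK x Kx).
have [P' [chiy [UP' oP' _ Py ylim]]] := selection_limit Uom om_free K_escapes (omK y Ky).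
(* The separating function has limit 0 along [x] and 1 along [y]. *)
have chixy : chix <> chiy.
  move=> E; have [g [gx gy]] := higson_separation xy.
  have gx0 : \val chix (\pi_(higson_quot X) g) = 0.
    apply: (complex_cvg_unique omF (xlim g)).
    have -> : (fun n => \val g (x n)) = cst 0 by exact/funext.
    exact: cvg_cst.
  have gy1 : \val chiy (\pi_(higson_quot X) g) = 1.
    apply: (complex_cvg_unique omF (ylim g)).
    have -> : (fun n => \val g (y n)) = cst 1 by exact/funext.
    exact: cvg_cst.
  by move: gx0; rewrite E gy1 => /eqP; rewrite oner_eq0.
have fibre chi : limit_set om K chi -> corona_map hf chi = corona_map hf chix.
  have KfM n z z' : K n z -> K n z' -> mdist (f z) (f z') <= M by exact/fM/cK.
  exact: (limit_set_fibre hf Uom om_free K_escapes M0 KfM Kx xlim).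
have Lconn := limit_set_connected Uom om_free K_escapes r0 Kchain.
(* By lightness the component of [chix] in its fibre is a point, but it contains the connected limit
   set and so [chiy]. *)
suff : [set chix] chiy by move=> E; apply: chixy; rewrite E.
rewrite -(f_light (corona_map hf chix) chix)//.
exists (limit_set om K); last by exists P'.
by split=> //; exists P.
Qed.
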